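(* Let $a,b\in\mathbb{R}$ with $b>a>0$. Let $f,g:[a,b]\to\mathbb{R}$ be two Lebesgue integrable functions. Then the inequality $$\left|\widehat{\mathcal{P}}(f,g)\right|\le \left|\widehat{\mathcal{P}}(f,f)\right|^{\frac12}\cdot\left|\widehat{\mathcal{P}}(g,g)\right|^{\frac12}$$ holds and is sharp.
   Context: For $b>a>0$ and real functions $f,g$ on $[a,b]$, the (Pompeiu–Chebyshev) functional is $$\widehat{\mathcal{P}}(f,g)=\frac{b^3-a^3}{3}\int_a^b f(x)g(x)\,dx-\left(\int_a^b x f(x)\,dx\right)\left(\int_a^b x g(x)\,dx\right).$$ *)

(* Defs.v *)
From HB Require Import structures.
From mathcomp Require Import all_boot all_order all_algebra.
From mathcomp Require Import all_classical all_reals all_analysis.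
Import Order.TTheory GRing.Theory Num.Theory.
Import numFieldNormedType.Exports.

Set Implicit Arguments.
Unset Strict Implicit.
Unset Printing Implicit Defensive.

Local Open Scope classical_set_scope.
Local Open Scope ring_scope.
Local Open Scope ereal_scope.

(* The complete Lebesgue measure is used, so that measurability means
   Lebesgue measurability: the library's lebesgue_measure lives on the Borel
   sets.  Functions on [a, b] are represented by functions R -> R of which only
   the values on [a, b] matter. *)
Definition L1 (R : realType) (a b : R) (f : R -> R) : Prop :=
  (@completed_lebesgue_measure R).-integrable `[a, b] (EFin \o f).

(* Extended-real valued: for f and g merely integrable, f * g need not be
   integrable.  The functional is finite when f and g are square integrable.
   If f is integrable but not square integrable (and 0 < a < b) then
   pompeiu_chebyshev a b f f = +oo.  When both the positive and the negative
   part of f * g have infinite integral, the convention +oo - +oo = -oo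
   applies. *)
Definition pompeiu_chebyshev (R : realType) (a b : R) (f g : R -> R) : \bar R :=
  let mu := @completed_lebesgue_measure R in
  ((b ^+ 3 - a ^+ 3) / 3)%R%:E * (\int[mu]_(x in `[a, b]) (f x * g x)%R%:E)
  - (\int[mu]_(x in `[a, b]) ((x : R) * f x)%R%:E) *
    (\int[mu]_(x in `[a, b]) ((x : R) * g x)%R%:E).

(* Main.v *)
Require Import Defs.
From HB Require Import structures.
From mathcomp Require Import all_boot all_order all_algebra.
From mathcomp Require Import all_classical all_reals all_analysis.
From mathcomp Require Import measurable_realfun ring lra.
Import Order.TTheory GRing.Theory Num.Theory.
Import numFieldNormedType.Exports.

Local Open Scope classical_set_scope.
Local Open Scope ring_scope.
Local Open Scope ereal_scope.

(** Let [K = (b^3 - a^3) / 3], the integral of [x^2] over the segment from [a]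
    to [b], and let [f~ = f - (int x f / K) x] be the component of [f]
    orthogonal to the identity function.  Expanding the product and using
    [int x^2 = K] gives
      [P(f, g) = K * int f~ g~],
    so [P] is [K] times an L^2 inner product of orthogonal components, and the
    inequality is the Cauchy-Schwarz inequality for [f~] and [g~]
    ([cauchy_schwarz_integral], an instance of Hoelder's inequality).

    As [f] and [g] are only integrable, the integrals of [f g], [f^2], [g^2] may
    be infinite.  The bounded weight makes [f g - f~ g~] integrable in any case
    ([integrable_correction]), which settles these cases:
    - the identity for [P(f, f)] always holds: [f^2] and [f~^2] are nonnegative,
      so both of their integrals are finite or both are [+oo] ([wcheb_self]);
    - the identity for [P(f, g)] is used only when the right-hand side of
      Cauchy-Schwarz is finite, and then [f~ g~] is integrable
      ([wcheb_residual]); when it is [+oo] there is nothing to prove.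
    With [0 * +oo = 0] this includes the case [P(g, g) = 0], [P(f, f) = +oo],
    where Cauchy-Schwarz forces [f~ g~ = 0] almost everywhere.

    The argument works for any weight [w] with [0 < int w^2 < +oo] in place of
    the identity, provided that [w f] and [w g] are integrable, and is carried
    out in that generality.

    For sharpness take [f = g = 1]: equality is then automatic, and
    [P(1, 1) = (b - a)^4 / 12] is positive and finite
    ([pompeiu_chebyshev_cst1]), so that no constant below [1] can do. *)

(** * Chebyshev functional with a square integrable weight *)

Section weighted.
Context {d : measure_display} {T : measurableType d} {R : realType}.
Variables (mu : {measure set T -> \bar R}) (D : set T).
Hypothesis mD : measurable D.

(** Both sides may be infinite; Hoelder's inequality is applied to the
    extensions by zero of the two functions outside [D]. *)
Lemma cauchy_schwarz_integral (u v : T -> R) :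
  measurable_fun D u -> measurable_fun D v ->
  \int[mu]_(x in D) `|(u x * v x)%:E| <=
    (\int[mu]_(x in D) (u x * u x)%:E) `^ (1 / 2)%R *
    (\int[mu]_(x in D) (v x * v x)%:E) `^ (1 / 2)%R.
Proof.
move=> mu_ mv.
have L2E (h : T -> R) : Lnorm mu 2%:E (EFin \o (h \_ D)) =
    (\int[mu]_(x in D) (h x * h x)%:E) `^ (1 / 2)%R.
  rewrite unlock div1r [in RHS]integral_mkcond; congr (_ `^ _).
  apply: eq_integral => x _ /=; rewrite patchE [in RHS]patchE.
  case: ifPn => _ /=; last by rewrite normr0 powR0.
  by rewrite powR_mulrn// real_normK ?num_real// expr2.
rewrite -!L2E integral_mkcond.
have m2 : (2^-1 + 2^-1 = 1 :> R)%R by lra.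
have := @hoelder _ _ _ mu (u \_ D) (v \_ D) 2 2
  ((measurable_restrictT u mD).1 mu_) ((measurable_restrictT v mD).1 mv)
  (ltr0Sn _ 1) (ltr0Sn _ 1) m2.
apply: le_trans; rewrite Lnorm1 le_eqVlt; apply/orP; left; apply/eqP.
apply: eq_integral => x _ /=; rewrite !patchE.
by case: ifPn => _ //; rewrite mul0r normr0.
Qed.

Variables (w : T -> R) (K : R).
Hypotheses (K0 : (0 < K)%R)
  (iww : mu.-integrable D (fun x => (w x * w x)%:E))
  (Iww : \int[mu]_(x in D) (w x * w x)%:E = K%:E).

Definition wcheb (f g : T -> R) : \bar R :=
  K%:E * (\int[mu]_(x in D) (f x * g x)%:E)
  - (\int[mu]_(x in D) (w x * f x)%:E) * (\int[mu]_(x in D) (w x * g x)%:E).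

Definition wmoment (f : T -> R) : R := (\int[mu]_(x in D) (w x * f x))%R.

(** The component of [f] orthogonal to [w] in the inner product [int f g]. *)
Definition residual (f : T -> R) (x : T) : R := (f x - wmoment f / K * w x)%R.

Definition wint (f : T -> R) := mu.-integrable D (fun x => (w x * f x)%:E).

Lemma wmomentE h : wint h -> \int[mu]_(x in D) (w x * h x)%:E = (wmoment h)%:E.
Proof.
by move=> wh; rewrite /wmoment /Rintegral fineK//; exact: integrable_fin_num.
Qed.

(** The difference between [f * g] and the product of the residuals, arranged so
    that each term has a factor [w]: this makes it integrable even when [f * g]
    is not. *)
Definition correction (f g : T -> R) x :=
  (wmoment f / K * (w x * g x) + (wmoment g / K * (w x * f x) +
    (- (wmoment f / K * (wmoment g / K)) * (w x * w x))))%R.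

Lemma residualM f g x :
  (f x * g x = residual f x * residual g x + correction f g x)%R.
Proof. by rewrite /residual /correction; ring. Qed.

(** The integral uses that [w] itself has moment [K]: the three terms are
    [F G / K], [F G / K] and [- F G / K], for [F] and [G] the two moments. *)
Lemma integrable_correction f g : wint f -> wint g ->
  mu.-integrable D (EFin \o correction f g) /\
  \int[mu]_(x in D) (correction f g x)%:E = (wmoment f * wmoment g / K)%:E.
Proof.
move=> wf wg.
have E : EFin \o correction f g =
   (fun x => (wmoment f / K)%:E * (w x * g x)%:E) \+
   ((fun x => (wmoment g / K)%:E * (w x * f x)%:E) \+
    (fun x => (- (wmoment f / K * (wmoment g / K)))%:E * (w x * w x)%:E)).
  by apply/funext => x /=; rewrite -!EFinM -!EFinD.
have i1 := integrableZl mD (wmoment f / K) wg.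
have i2 := integrableZl mD (wmoment g / K) wf.
have i3 := integrableZl mD (- (wmoment f / K * (wmoment g / K))) iww.
have i23 := integrableD mD i2 i3.
split; first by rewrite E; exact: integrableD.
transitivity (\int[mu]_(x in D) (EFin \o correction f g) x); first by [].
rewrite E integralD//= integralD//= !integralZl// Iww !wmomentE//.
rewrite -!EFinM -!EFinD.
by congr EFin; field; rewrite gt_eqF.
Qed.

(** Integrability makes every integral involved finite, so that the identity is
    one between real numbers. *)
Lemma wcheb_residual f g : wint f -> wint g ->
  mu.-integrable D (fun x => (residual f x * residual g x)%:E) ->
  wcheb f g = K%:E * \int[mu]_(x in D) (residual f x * residual g x)%:E.
Proof.
move=> wf wg ir; have [ic Ic] := integrable_correction _ _ wf wg.
rewrite /wcheb !wmomentE//.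
under eq_integral do rewrite residualM EFinD.
rewrite integralD//= Ic.
have /fineK <- := integrable_fin_num mD ir.
rewrite -!(EFinM, EFinD); congr EFin; field.
by rewrite gt_eqF.
Qed.

Lemma integral_ge0_nintegrable (h : T -> R) : measurable_fun D h ->
  (forall x, 0 <= h x)%R -> ~ mu.-integrable D (EFin \o h) ->
  \int[mu]_(x in D) (h x)%:E = +oo.
Proof.
move=> mh h0 nh; apply/eqP; rewrite -leye_eq leNgt; apply/negP => lty.
apply: nh; apply/integrableP; split; first exact/measurable_EFinP.
by under eq_integral do rewrite /= ger0_norm//.
Qed.

Lemma measurable_residual f : measurable_fun D w -> measurable_fun D f ->
  measurable_fun D (residual f).
Proof.
move=> mw mf; apply: measurable_funB => //.
by apply: measurable_funM => //; exact: measurable_cst.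
Qed.

(** Squares are nonnegative, hence the identity persists when [f] is not square
    integrable over [D]: both sides are then [+oo]. *)
Lemma wcheb_self f : measurable_fun D w -> measurable_fun D f -> wint f ->
  wcheb f f = K%:E * \int[mu]_(x in D) (residual f x * residual f x)%:E.
Proof.
move=> mw mf wf; have mr := measurable_residual _ mw mf.
have [ir|nir] := pselect (mu.-integrable D
  (fun x => (residual f x * residual f x)%:E)); first exact: wcheb_residual.
have [ic _] := integrable_correction _ _ wf wf.
rewrite /wcheb !wmomentE// !integral_ge0_nintegrable//.
- by rewrite gt0_muley ?lte_fin// -EFinM addye// -EFinN.
- exact: measurable_funM.
- by move=> x; rewrite -expr2 sqr_ge0.
- exact: measurable_funM.
- by move=> x; rewrite -expr2 sqr_ge0.
- move=> iff; apply: nir.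
  have := integrableB mD iff ic; apply: eq_integrable => // x _ /=.
  by rewrite residualM -EFinB addrK.
Qed.

(** The constant [K] splits as [K^(1/2) * K^(1/2)] over the two norms, so it
    suffices to bound the integral of the product of the residuals. *)
Lemma wcheb_le f g : measurable_fun D w ->
  measurable_fun D f -> measurable_fun D g -> wint f -> wint g ->
  `|wcheb f g| <= `|wcheb f f| `^ (1 / 2)%R * `|wcheb g g| `^ (1 / 2)%R.
Proof.
move=> mw mf mg wf wg.
have mrf := measurable_residual _ mw mf.
have mrg := measurable_residual _ mw mg.
have sq0 h : 0 <= \int[mu]_(x in D) (h x * h x)%:E.
  by apply: integral_ge0 => x _; rewrite lee_fin -expr2 sqr_ge0.
have Ke0 : 0 <= K%:E by rewrite lee_fin ltW.
have -> : `|wcheb f f| `^ (1 / 2)%R * `|wcheb g g| `^ (1 / 2)%R =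
   K%:E * ((\int[mu]_(x in D) (residual f x * residual f x)%:E) `^ (1 / 2)%R *
    (\int[mu]_(x in D) (residual g x * residual g x)%:E) `^ (1 / 2)%R).
  rewrite !wcheb_self// !gee0_abs ?mule_ge0// !poweRM// muleACA; congr (_ * _).
  rewrite /= -EFinM -powRD; last by rewrite gt_eqF ?implybT.
  by rewrite -splitr powRr1// ltW.
set B := _ `^ _ * _ `^ _.
have CS : _ <= B := cauchy_schwarz_integral _ _ mrf mrg.
(* A finite bound makes the product of the residuals integrable. *)
have [->|By] := eqVneq B +oo; first by rewrite gt0_muley ?lte_fin// leey.
have mfg : measurable_fun D (fun x => (residual f x * residual g x)%:E).
  by apply/measurable_EFinP; exact: measurable_funM.
rewrite wcheb_residual//; last first.
  by apply/integrableP; split => //; rewrite (le_lt_trans CS)// ltey.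
rewrite abseM gee0_abs// lee_wpmul2l//.
exact: le_trans (le_abse_integral _ mD mfg) CS.
Qed.

End weighted.

(** * Integrals for the completed Lebesgue measure *)

Section completed_lebesgue.
Context {R : realType}.
Local Notation mu := (@completed_lebesgue_measure R).

(** The line with its Lebesgue measurable sets; [measurableTypeR R] carries only
    the Borel sets. *)
Local Notation X := (caratheodory_type (R:=R) ((wlength idfun)^*)%mu).

Lemma measurable_id_completed :
  measurable_fun [set: X] (fun x : X => x : measurableTypeR R).
Proof.
by move=> _ Y mY; rewrite setTI; exact: sub_caratheodory mY.
Qed.

(** Lebesgue measure is the pushforward of its completion along the identity
    map, so a Borel function has the same integral for both. *)
Lemma ge0_integral_completed (D : set R) (f : R -> R) :
  measurable (D : set (measurableTypeR R)) ->
  measurable_fun (D : set (measurableTypeR R)) (f : measurableTypeR R -> R) ->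
  {in D, forall x, 0 <= f x}%R ->
  \int[mu]_(x in D) (f x)%:E = \int[lebesgue_measure]_(x in D) (f x)%:E.
Proof.
move=> mD mf f0.
have mfE := (measurable_EFinP _ _).2 mf.
exact: esym (@ge0_integral_pushforward _ _ _ _ R _ measurable_id_completed mu D
  (EFin \o f) mD mfE f0).
Qed.

Lemma integral_exprn (a b : R) (n : nat) : (0 <= a)%R -> (a < b)%R ->
  \int[mu]_(x in `[a, b]) ((x : R) ^+ n)%:E =
  ((b ^+ n.+1 - a ^+ n.+1) / n.+1%:R)%R%:E.
Proof.
move=> a0 ab.
rewrite (@ge0_integral_completed _ (fun x : R => x ^+ n)%R); last 3 first.
- exact: measurable_itv.
- exact: exprn_measurable.
- move=> x; rewrite inE/= in_itv/= => /andP[ax _].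
  by rewrite exprn_ge0// (le_trans a0).
pose F (x : R) := (n.+1%:R^-1 * x ^+ n.+1)%R.
have dF (x : R) : is_derive x (1%R : R) F (x ^+ n)%R.
  have -> : F = (n.+1%:R^-1 \*: (id ^+ n.+1))%R.
    by apply/funext => y; rewrite /F /= fctE.
  apply: is_derive_eq; rewrite /= scaler1.
  by rewrite scalerA mulVf// scale1r.
rewrite (@continuous_FTC2 _ (fun x : R => x ^+ n)%R F)//.
- by rewrite -EFinB /F -mulrBr mulrC.
- by apply: continuous_subspaceT => x; exact: exprn_continuous.
- have cF (x : R) : {for x, continuous F}.
    apply/differentiable_continuous/derivable1_diffP.
    exact: (@ex_derive _ _ _ _ _ _ _ (dF x)).
  split.
  + by move=> x _; exact: (@ex_derive _ _ _ _ _ _ _ (dF x)).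
  + by apply: cvg_at_right_filter; exact: cF.
  + by apply: cvg_at_left_filter; exact: cF.
- by move=> x _; rewrite derive1E (@derive_val _ _ _ _ _ _ _ (dF x)).
Qed.

(** * The functional of Pompeiu and Chebyshev *)

Lemma measurable_segment_completed (a b : R) :
  measurable (`[a, b]%classic : set X).
Proof. by apply: sub_caratheodory; exact: measurable_itv. Qed.

Lemma measurable_id_segment (a b : R) :
  measurable_fun (`[a, b]%classic : set X) (fun x : X => x : R).
Proof. exact: measurable_funTS measurable_id_completed. Qed.

Lemma bounded_id_segment (a b : R) :
  [bounded (x : R) | x in (`[a, b]%classic : set X)].
Proof.
exists (Num.max `|a| `|b|)%R; split; first exact: num_real.
move=> M /ltW; rewrite ge_max => /andP[aM bM] x /=.
rewrite in_itv/= => /andP[ax xb].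
rewrite ler_norml; apply/andP; split.
  by rewrite (le_trans _ ax)// lerNl (le_trans _ aM)// -normrN ler_norm.
by rewrite (le_trans xb)// (le_trans _ bM)// ler_norm.
Qed.

Lemma L1_wint (a b : R) (f : R -> R) : L1 a b f ->
  wint mu (`[a, b]%classic : set X) (fun x : X => x : R) f.
Proof.
move=> f1.
exact: (integrableMr (measurable_segment_completed a b)
  (measurable_id_segment a b) (bounded_id_segment a b) f1).
Qed.

Lemma pompeiu_chebyshev_le (a b : R) (f g : R -> R) : (0 < a)%R -> (a < b)%R ->
  L1 a b f -> L1 a b g ->
  `|pompeiu_chebyshev a b f g| <=
    `|pompeiu_chebyshev a b f f| `^ (1 / 2)%R *
    `|pompeiu_chebyshev a b g g| `^ (1 / 2)%R.
Proof.
move=> a0 ab f1 g1.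
have K0 : (0 < (b ^+ 3 - a ^+ 3) / 3)%R.
  by rewrite divr_gt0// subr_gt0 ltrXn2r// ltW.
have mL h : L1 a b h -> measurable_fun (`[a, b]%classic : set X) h.
  by move=> /measurable_int/measurable_EFinP.
have mid := measurable_id_segment a b.
have Ixx : \int[mu]_(x in `[a, b]) ((x : R) * x)%:E =
    ((b ^+ 3 - a ^+ 3) / 3)%R%:E.
  by rewrite -(integral_exprn a b 2 (ltW a0) ab).
have ixx : mu.-integrable `[a, b] (fun x => ((x : R) * x)%:E).
  apply/integrableP; split.
    by apply/measurable_EFinP; exact: measurable_funM.
  under eq_integral => x _ do
    rewrite gee0_abs ?lee_fin -?expr2 ?sqr_ge0// expr2.
  by rewrite Ixx ltry.
exact: (wcheb_le mu _ (measurable_segment_completed a b) _ _ K0 ixx Ixx f g mid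
  (mL _ f1) (mL _ g1) (L1_wint _ _ _ f1) (L1_wint _ _ _ g1)).
Qed.

Lemma L1_cst1 (a b : R) : (0 < a)%R -> (a < b)%R -> L1 a b (cst 1%R).
Proof.
move=> a0 ab; apply/integrableP; split.
  exact/measurable_EFinP/measurable_cst.
under eq_integral => x _ do rewrite /= normr1 -(expr0 (x : R)).
by rewrite integral_exprn ?ltW// ltry.
Qed.

Lemma pompeiu_chebyshev_cst1 (a b : R) : (0 < a)%R -> (a < b)%R ->
  pompeiu_chebyshev a b (cst 1%R) (cst 1%R) = ((b - a) ^+ 4 / 12)%:E.
Proof.
move=> a0 ab.
have I0 : \int[mu]_(x in `[a, b]) (1 * 1 : R)%:E = (b - a)%:E.
  have := integral_exprn a b 0 (ltW a0) ab; rewrite !expr1 divr1 => <-.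
  by apply: eq_integral => x _; rewrite mulr1 expr0.
have I1 : \int[mu]_(x in `[a, b]) ((x : R) * 1)%:E = ((b ^+ 2 - a ^+ 2) / 2)%:E.
  have <- := integral_exprn a b 1 (ltW a0) ab.
  by apply: eq_integral => x _; rewrite mulr1 expr1.
rewrite /pompeiu_chebyshev /cst I0 I1 -!(EFinM, EFinN, EFinD).
by congr EFin; field.
Qed.

End completed_lebesgue.

Theorem theorem3 (R : realType) (a b : R) (ha : (0 < a)%R) (hab : (a < b)%R) :
  (* the inequality *)
  (forall f g : R -> R, L1 a b f -> L1 a b g ->
     `|pompeiu_chebyshev a b f g| <=
       `|pompeiu_chebyshev a b f f| `^ (1 / 2)%R *
       `|pompeiu_chebyshev a b g g| `^ (1 / 2)%R) /\
  (* sharpness: the constant 1 is best possible *)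
  (forall k : R,
     (forall f g : R -> R, L1 a b f -> L1 a b g ->
        `|pompeiu_chebyshev a b f g| <=
          k%:E * (`|pompeiu_chebyshev a b f f| `^ (1 / 2)%R *
                  `|pompeiu_chebyshev a b g g| `^ (1 / 2)%R)) ->
     (1 <= k)%R) /\
  (* sharpness: equality is attained at a nonzero finite value *)
  (exists f g : R -> R,
     [/\ L1 a b f, L1 a b g, 0 < `|pompeiu_chebyshev a b f g| < +oo &
         `|pompeiu_chebyshev a b f g| =
           `|pompeiu_chebyshev a b f f| `^ (1 / 2)%R *
           `|pompeiu_chebyshev a b g g| `^ (1 / 2)%R]).
Proof.
have P0 : (0 < (b - a) ^+ 4 / 12)%R.
  by rewrite divr_gt0// exprn_gt0// subr_gt0.
have f1 := L1_cst1 a b ha hab.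
have P1 : `|pompeiu_chebyshev a b (cst 1%R) (cst 1%R)| = ((b - a) ^+ 4 / 12)%:E.
  by rewrite pompeiu_chebyshev_cst1// gee0_abs// lee_fin ltW.
have sq (x : \bar R) : 0 <= x -> x `^ (1 / 2)%R * x `^ (1 / 2)%R = x.
  move=> x0; rewrite -poweRD -?splitr ?poweRe1//.
  by rewrite poweRD_defE -splitr oner_eq0.
split; first by move=> f g; exact: pompeiu_chebyshev_le.
split.
- move=> k /(_ _ _ f1 f1).
  by rewrite sq// P1 -EFinM lee_fin ler_pMl.
- exists (cst 1%R), (cst 1%R); split=> //; last by rewrite sq.
  by rewrite P1 lte_fin P0 ltry.
Qed.
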